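(* Let $d\ge 1$ and let $P=\{p_1,\ldots,p_d\}$ and $Q=\{q_1,\ldots,q_d\}$ be finite posets with $d$ elements each. Set $P'=\{p_{d+1}\}\oplus P$ and $Q'=\{q_{d+1}\}\oplus Q$, where $p_{d+1}$ and $q_{d+1}$ are new elements. If $P$ and $Q$ possess a common linear extension, then all six of the polytopes $$\Omega(\mathcal{O}_P,\mathcal{O}_Q),\ \Omega(\mathcal{O}_P,\mathcal{C}_Q),\ \Omega(\mathcal{C}_P,\mathcal{C}_Q),\ \Gamma(\mathcal{O}_{P'},\mathcal{O}_{Q'}),\ \Gamma(\mathcal{O}_{P'},\mathcal{C}_{Q'}),\ \Gamma(\mathcal{C}_{P'},\mathcal{C}_{Q'})$$ in $\mathbb{R}^{d+1}$ have the same Ehrhart polynomial. In particular, these polytopes have the same volume.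
   Context: Linear extensions. A linear extension of a finite poset $P=\{p_1,\ldots,p_d\}$ is a permutation $\sigma=i_1i_2\cdots i_d$ of $[d]=\{1,\ldots,d\}$ such that $a<b$ whenever $p_{i_a}<p_{i_b}$ in $P$. Posets $P=\{p_1,\ldots,p_d\}$ and $Q=\{q_1,\ldots,q_d\}$ possess a common linear extension if some permutation of $[d]$ is a linear extension of both $P$ and $Q$. Ordinal sum. For (disjoint) finite posets $P$ and $Q$, $P\oplus Q$ is the poset on $P\cup Q$ with $s\le t$ if (a) $s,t\in P$ and $s\le t$ in $P$, or (b) $s,t\in Q$ and $s\le t$ in $Q$, or (c) $s\in P$ and $t\in Q$. Thus $P'=\{p_{d+1}\}\oplus P=\{p_1,\ldots,p_{d+1}\}$ is $P$ with a new least element $p_{d+1}$, and similarly for $Q'=\{q_1,\ldots,q_{d+1}\}$. Order polytope. For a finite poset $P=\{p_1,\ldots,p_n\}$, $\mathcal{O}_P\subset\mathbb{R}^n$ is the set of $(x_1,\ldots,x_n)$ with $0\le x_i\le 1$ for $1\le i\le n$ and $x_i\ge x_j$ whenever $p_i\le p_j$ in $P$. Chain polytope. $\mathcal{C}_P\subset\mathbb{R}^n$ is the set of $(x_1,\ldots,x_n)$ with $x_i\ge 0$ for $1\le i\le n$ and $x_{i_1}+\cdots+x_{i_k}\le 1$ for every maximal chain $p_{i_1}<\cdots<p_{i_k}$ of $P$. Both are integral convex polytopes of dimension $n$ (integral: all vertices have integer coordinates). The same definitions apply to $Q$, $P'$, $Q'$ with the indicated indexing of elements. For integral convex polytopes $\mathcal{P},\mathcal{Q}\subset\mathbb{R}^n$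 of dimension $n$, with $-\mathcal{Q}=\{-y:y\in\mathcal{Q}\}$, $$\Gamma(\mathcal{P},\mathcal{Q})=\operatorname{conv}\{\mathcal{P}\cup(-\mathcal{Q})\}\subset\mathbb{R}^n,\qquad \Omega(\mathcal{P},\mathcal{Q})=\operatorname{conv}\{(\mathcal{P}\times\{1\})\cup((-\mathcal{Q})\times\{-1\})\}\subset\mathbb{R}^{n+1}.$$ The Ehrhart polynomial of an integral convex polytope $\mathcal{P}\subset\mathbb{R}^n$ of dimension $n$ is the polynomial function $i(\mathcal{P},m)=|m\mathcal{P}\cap\mathbb{Z}^n|$, $m=1,2,\ldots$, where $m\mathcal{P}=\{m\alpha:\alpha\in\mathcal{P}\}$. Volume is the usual Euclidean volume. *)

(* Defs.v *)
From HB Require Import structures.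
From mathcomp Require Import all_boot all_order all_algebra all_fingroup.
From mathcomp Require Import finmap.
From mathcomp Require Import all_classical all_reals all_analysis.

Set Implicit Arguments.
Unset Strict Implicit.
Unset Printing Implicit Defensive.

Import Order.TTheory GRing.Theory Num.Theory.
Local Open Scope classical_set_scope.
Local Open Scope ring_scope.

Definition ordsum (S T : Type) : Type := (S + T)%type.

Fact ordsum_display (dS dT : Order.disp_t) : Order.disp_t.
Proof. exact: (Order.Disp tt tt). Qed.

Section OrdinalSum.
Context {dS dT : Order.disp_t} (S : finPOrderType dS) (T : finPOrderType dT).

Definition ordsum_le (x y : ordsum S T) : bool :=
  match x, y with
  | inl s, inl t => (s <= t)%O
  | inr s, inr t => (s <= t)%O
  | inl _, inr _ => true
  | inr _, inl _ => false
  end.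

Fact ordsum_le_refl : reflexive ordsum_le.
Proof. by case=> x /=; exact: lexx. Qed.

Fact ordsum_le_anti : antisymmetric ordsum_le.
Proof. by move=> [x|x] [y|y] //= /le_anti ->. Qed.

Fact ordsum_le_trans : transitive ordsum_le.
Proof. by move=> [y|y] [x|x] [z|z] //=; exact: le_trans. Qed.

HB.instance Definition _ := Finite.copy (ordsum S T) (S + T)%type.
HB.instance Definition _ := Order.Le_isPOrder.Build (ordsum_display dS dT)
  (ordsum S T) ordsum_le_refl ordsum_le_anti ordsum_le_trans.

End OrdinalSum.

(* A poset P = {p_1, ..., p_n} is a [finPOrderType] with a bijective labelling
   [p : 'I_n -> P]; the index k is the ordinal k - 1. *)

(* In [sigma = i_1 ... i_d], [i_a] is [sigma a]. *)
Definition linear_extension {disp : Order.disp_t} {P : finPOrderType disp}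
    {d : nat} (p : 'I_d -> P) (sigma : 'S_d) : Prop :=
  forall a b : 'I_d, (p (sigma a) < p (sigma b))%O -> (a < b)%N.

(* The one-element poset is ['I_1]; the new least element takes the last label
   [ord_max] and the elements of P keep theirs. *)
Definition add_bottom {disp : Order.disp_t} {P : finPOrderType disp} {d : nat}
    (p : 'I_d -> P) (i : 'I_d.+1) : ordsum 'I_1 P :=
  if unlift ord_max i is Some j then inr (p j) else inl ord0.

Definition is_chain {disp : Order.disp_t} {P : finPOrderType disp}
    (C : {set P}) : bool :=
  [forall x in C, forall y in C, (x >=< y)%O].

Definition maximal_chain {disp : Order.disp_t} {P : finPOrderType disp}
    (C : {set P}) : bool :=
  maxset is_chain C.

Section PosetPolytopes.
Context (R : realType) {disp : Order.disp_t} {P : finPOrderType disp} {n : nat}.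
Variable p : 'I_n -> P.

Definition order_polytope : set 'rV[R]_n :=
  [set x | (forall i, 0 <= x ord0 i <= 1) /\
           (forall i j, (p i <= p j)%O -> x ord0 j <= x ord0 i)].

Definition chain_polytope : set 'rV[R]_n :=
  [set x | (forall i, 0 <= x ord0 i) /\
           (forall C : {set P}, maximal_chain C ->
              \sum_(i | p i \in C) x ord0 i <= 1)].

End PosetPolytopes.

Section Polytopes.
Context {R : realType} {n : nat}.
Implicit Types A B : set 'rV[R]_n.

Definition conv A : set 'rV[R]_n :=
  smallest (@convex_set R 'rV[R]_n) A.

Definition lift_height (x : 'rV[R]_n) (t : R) : 'rV[R]_n.+1 :=
  \row_i (if unlift ord_max i is Some j then x ord0 j else t).

Definition Gamma A B : set 'rV[R]_n := conv (A `|` [set - y | y in B]).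

(* Ehrhart function i(A, m) for A bounded; [fset_set] of an infinite set is
   [fset0]. *)
Definition ehrhart A (m : nat) : nat :=
  #|` fset_set [set z : 'rV[int]_n |
                 [set m%:R *: x | x in A] (map_mx intr z)] |.

End Polytopes.

Definition Omega {R : realType} {n : nat} (A B : set 'rV[R]_n) :
    set 'rV[R]_n.+1 :=
  conv ([set lift_height x 1 | x in A] `|`
        [set lift_height (- y) (- 1) | y in B]).

Section ProductCons.
Context d (T : measurableType d) (R : realType) (n : nat).
Variables (m1 : {sigma_finite_measure set T -> \bar R})
  (m2 : {sigma_finite_measure set (n.-tuple T) -> \bar R}).

Definition tuple_cons (xt : (T * n.-tuple T)%type) : n.+1.-tuple T :=
  [tuple of xt.1 :: xt.2].

Lemma measurable_tuple_cons : measurable_fun [set: (T * n.-tuple T)%type] tuple_cons.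
Proof. exact: measurable_cons. Qed.

Definition product_cons : set (n.+1.-tuple T) -> \bar R :=
  pushforward (m1 \x m2)%E tuple_cons.

Let product_cons0 : product_cons set0 = 0%E.
Proof. by rewrite /product_cons /pushforward preimage_set0 measure0. Qed.

Let product_cons_ge0 A : (0 <= product_cons A)%E.
Proof. by rewrite /product_cons /pushforward measure_ge0. Qed.

Let product_cons_additive : semi_sigma_additive product_cons.
Proof.
have mf := measurable_tuple_cons.
move=> F mF tF mUF; rewrite /product_cons /pushforward preimage_bigcup.
apply: measure_semi_sigma_additive.
- by move=> k; rewrite -[X in measurable X]setTI; exact: mf.
- apply/trivIsetP => /= i j _ _ ij; rewrite -preimage_setI.
  by move/trivIsetP : tF => /(_ _ _ _ _ ij) ->//; rewrite preimage_set0.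
- by rewrite -preimage_bigcup -[X in measurable X]setTI; exact: mf.
Qed.

HB.instance Definition _ := isMeasure.Build _ _ _ product_cons
  product_cons0 product_cons_ge0 product_cons_additive.

Let product_cons_sigma_finite : sigma_finite setT product_cons.
Proof.
pose g (t : n.+1.-tuple T) : (T * n.-tuple T)%type :=
  (tnth t ord0, [tuple of behead t]).
have gK : cancel g tuple_cons by move=> t; rewrite /g /tuple_cons -tuple_eta.
have fK : cancel tuple_cons g.
  by case=> x t; rewrite /g /tuple_cons /=; congr pair; apply: val_inj.
have mg : measurable_fun setT g.
  apply: measurable_fun_pair; first exact: measurable_tnth.
  exact: measurable_behead.
have /sigma_finiteP[F [TF ndF Foo]] := sigma_finiteT m1.
have /sigma_finiteP[G [TG ndG Goo]] := sigma_finiteT m2.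
exists (fun k => g @^-1` (F k `*` G k)).
  rewrite -preimage_bigcup (_ : \bigcup_k (F k `*` G k) = setT) ?preimage_setT//.
  apply/seteqP; split=> // -[x y] _.
  have [k _ Fkx] : (\bigcup_k F k) x by rewrite -TF.
  have [l _ Gly] : (\bigcup_k G k) y by rewrite -TG.
  exists (maxn k l) => //; split.
    by move: x Fkx; exact/subsetPset/ndF/leq_maxl.
  by move: y Gly; exact/subsetPset/ndG/leq_maxr.
move=> k; have [mF m1F] := Foo k; have [mG m2G] := Goo k; split.
  by rewrite -[X in measurable X]setTI; apply: mg => //; exact: measurableX.
rewrite /product_cons /pushforward -comp_preimage.
rewrite (_ : g \o tuple_cons = id); last exact/funext.
by rewrite preimage_id product_measure1E// lte_mul_pinfty// ge0_fin_numE.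
Qed.

HB.instance Definition _ := Measure_isSigmaFinite.Build _ _ _ product_cons
  product_cons_sigma_finite.

End ProductCons.

(* Dirac measure on the one-point space R^0, and the product measure
   [lebesgue_measure \x lebesgue_tuple n] transported to (n+1)-tuples. *)
Fixpoint lebesgue_tuple (R : realType) (n : nat) :
    {sigma_finite_measure set (n.-tuple (measurableTypeR R)) -> \bar R} :=
  match n with
  | 0 => \d_ ([tuple] : 0.-tuple (measurableTypeR R))
  | n.+1 => product_cons lebesgue_measure (lebesgue_tuple R n)
  end.

Definition volume {R : realType} {n : nat} (A : set 'rV[R]_n) : \bar R :=
  lebesgue_tuple R n [set t | A (\row_i tnth t i)].

(* Main.v *)
Require Import Defs.
From mathcomp Require Import all_boot all_order all_algebra all_fingroup.
From mathcomp Require Import all_classical all_reals all_analysis.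
From mathcomp Require Import measurable_realfun ring lra.

(** The six polytopes are images of one and the same body under bijections of
    R^(d+1) which are piecewise linear, homogeneous for nonnegative scalars,
    volume preserving, and which permute the lattice points.  Such a bijection
    preserves the number of lattice points of every dilate and the volume.

    Reduction to Gamma.  The order polytope of P' is the pyramid with apex 0
    over O_P x {1} ([pyramid_order_polytope]).  As 0 is the midpoint of (0, 1)
    and (0, -1), the polytope Omega(A, B) contains the pyramids over A x {1}
    and -B x {-1}, hence equals Gamma(pyramid A, pyramid B)
    ([Omega_pyramid]).  So each of the six polytopes is some Gamma(B, C), where
    B is one of O_P', C_P', pyramid C_P, and C is one of O_Q', C_Q',
    pyramid C_Q.

    Transfer maps.  For a weighting y of the elements of a poset let
    heaviest(y) be the largest weight of a chain.  The chain polytope is the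
    set of y >= 0 with heaviest(y) <= 1, and Stanley's map, which adds to y_i
    the weight of the heaviest chain strictly above the i-th element, carries
    it onto the order polytope.  The pyramid over a chain polytope is obtained
    in the same way when only the coordinate of the bottom element is modified.
    The record [transfer] isolates what these maps y |-> y + U(y) have in
    common.

    Gluing.  Let U and V be the offsets for B and C.  Write w = w+ - w- with
    w+ and w- the positive and negative parts, and send w to
    (w+ + U(w+)) - (w- + V(w-)).  In the order of a common linear extension
    this map is triangular: the i-th coordinate is changed by an amount that
    depends only on later coordinates.  It is therefore a composition of
    shears, each modifying one coordinate by a function of the others; a shear
    preserves Lebesgue measure by Fubini and translation invariance
    ([lebesgue_tuple_shear]), and it preserves the lattice because the
    functions involved are built from coordinates by sums, differences and
    maxima.

    This map carries { w | heaviest_P'(w+) + heaviest_Q'(w-) <= 1 }, a body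
    that does not depend on the choice of B and C, onto Gamma(B, C)
    ([Gamma_untransfer]).  The point is that among all decompositions
    x = u - v with u in a B and v in b C, the one produced by the map is the
    smallest in every coordinate ([untransfer_minimal]). *)

Set Implicit Arguments.
Unset Strict Implicit.
Unset Printing Implicit Defensive.

Import Order.TTheory GRing.Theory Num.Theory.
Local Open Scope classical_set_scope.
Local Open Scope ring_scope.

(** * Shears preserve Lebesgue measure *)

Section Volume.
Context {R : realType}.
Let L := measurableTypeR R.

(** A measure on the line is determined by its values on half-open intervals,
    and translation keeps their length. *)
Lemma lebesgue_measure_translation (c : R) (A : set L) : measurable A ->
  lebesgue_measure [set x : L | A (x + c)] = lebesgue_measure A.
Proof.
move=> mA.
have mf : measurable_fun [set: L] (fun x : L => x + c : L).
  by apply: measurable_funD.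
pose mu := measure_function_pushforward__canonical__measure_function_Measure
  (@lebesgue_measure R) mf.
rewrite [RHS](@lebesgue_measure_unique R mu)// => X /ocitvP[->|[[a b] /= ab ->]].
  by rewrite !measure0.
rewrite /mu /= /pushforward [X in _ = lebesgue_measure X](_ : _ =
  `]a - c, b - c]%classic); last first.
  by apply/seteqP; split=> x /=; rewrite !in_itv/= lerBrDr ltrBlDr.
rewrite !lebesgue_measure_itv/= !lte_fin ltrD2r ab.
by rewrite -!EFinD; congr EFin; ring.
Qed.

Definition shear n (i : 'I_n) (g : n.-tuple L -> R) (t : n.-tuple L) :
    n.-tuple L :=
  [tuple tnth t j + (if j == i then g t else 0) | j < n].

Lemma measurable_shear n (i : 'I_n) (g : n.-tuple L -> R) :
  measurable_fun [set: n.-tuple L] (g : n.-tuple L -> L) ->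
  measurable_fun [set: n.-tuple L] (shear i g).
Proof.
move=> mg; apply/measurable_fun_tnthP => j.
rewrite (_ : _ \o _ = fun t => tnth t j + (if j == i then g t else 0)).
  apply: measurable_funD; first exact: measurable_tnth.
  by case: (j == i).
by apply/funext => t /=; rewrite tnth_mktuple.
Qed.

(** Induction on the dimension.  If the sheared coordinate is the first one,
    integrate over it innermost: on each line parallel to it, the shear is a
    translation.  Otherwise fix the first coordinate: on each slice the map is
    a shear in one dimension less. *)
Lemma lebesgue_tuple_shear n (i : 'I_n) (g : n.-tuple L -> R) (A : set (n.-tuple L)) :
  measurable_fun [set: n.-tuple L] (g : n.-tuple L -> L) ->
  (forall t u, (forall j, j != i -> tnth t j = tnth u j) -> g t = g u) ->
  measurable A ->
  lebesgue_tuple R n (shear i g @^-1` A) = lebesgue_tuple R n A.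
Proof.
elim: n i g A => [[]//|n IH] i g A mg gi mA.
rewrite /= /product_cons /pushforward.
have mc := @measurable_tuple_cons _ L n.
have mA1 : measurable (@tuple_cons _ L n @^-1` A).
  by rewrite -[X in measurable X]setTI; exact: mc.
have ms : measurable (@tuple_cons _ L n @^-1` (shear i g @^-1` A)).
  rewrite -[X in measurable X]setTI; apply: mc => //.
  by rewrite -[X in measurable X]setTI; exact: measurable_shear.
have [i0|[j ij]] : i = ord0 \/ exists j, i = lift ord0 j.
  by case: (unliftP ord0 i) => [j ->|->]; [right; exists j|left].
{ have mp2 X : measurable X -> (lebesgue_measure \x lebesgue_tuple R n)%E X =
      (lebesgue_measure \x^ lebesgue_tuple R n)%E X.
    by apply: product_measure_unique => //= B C mB mC; rewrite product_measure2E.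
  rewrite !mp2 // /product_measure2; apply: eq_integral => y _ /=.
  (* [g] ignores the first coordinate, so the value 0 there is arbitrary. *)
  pose c := g (@tuple_cons _ L n (0 : L, y)).
  rewrite -[RHS](@lebesgue_measure_translation c); last exact: measurable_ysection.
  congr (lebesgue_measure _); apply/seteqP; split=> x /=.
  all: rewrite /ysection /preimage /= ?inE/=.
  all: suff -> : shear i g (@tuple_cons _ L n (x, y)) = @tuple_cons _ L n (x + c, y) by [].
  all: apply: eq_from_tnth => k; rewrite tnth_mktuple i0.
  all: case: (unliftP ord0 k) => [l ->|->].
  all: rewrite ?tnthS ?tnth0 /= ?addr0 //; congr (_ + _); apply: gi => l.
  all: rewrite i0; case: (unliftP ord0 l) => [l' ->|->] //.
  all: by rewrite !tnthS. }
rewrite /product_measure1; apply: eq_integral => x _ /=.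
pose g' (t : n.-tuple L) := g (@tuple_cons _ L n (x, t)).
rewrite -[RHS](IH j g').
{ congr (lebesgue_tuple R n _).
  apply/seteqP; split=> t /=.
  all: rewrite /xsection /preimage /= ?inE/=.
  all: suff -> : shear i g (@tuple_cons _ L n (x, t)) = @tuple_cons _ L n (x, shear j g' t) by [].
  all: apply: eq_from_tnth => k; rewrite tnth_mktuple ij.
  all: case: (unliftP ord0 k) => [l ->|->].
  all: rewrite ?tnthS ?tnth0 /= ?addr0 //.
  all: by rewrite tnth_mktuple (inj_eq lift_inj). }
- apply: measurableT_comp => //; apply: (measurableT_comp mc).
  by apply: measurable_fun_pair.
- move=> t u tu; apply: gi => k; rewrite ij.
  case: (unliftP ord0 k) => [l ->|->]; last by rewrite !tnth0.
  by rewrite (inj_eq lift_inj) !tnthS => /tu.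
- exact: measurable_xsection.
Qed.

End Volume.

(** * Piecewise linear lattice equivalences *)

Section LatticeEquivalence.
Context {R : realType}.
Let L := measurableTypeR R.

Definition tuple_set n (X : set 'rV[R]_n) : set (n.-tuple L) :=
  [set t | X (\row_i tnth t i)].

Definition lattice_point n (x : 'rV[R]_n) := forall i, x ord0 i \is a Num.int.

(** The semantic properties of the functions obtained from coordinates by
    sums, differences and maxima that the counting and volume arguments use. *)
Definition tropical n (h : 'rV[R]_n -> R) :=
  [/\ measurable_fun [set: n.-tuple L] (fun t => h (\row_i tnth t i) : L),
      forall x, lattice_point x -> h x \is a Num.int &
      forall c x, 0 <= c -> h (c *: x) = c * h x].

Lemma tropical_coord n (i : 'I_n) : tropical (fun x : 'rV[R]_n => x ord0 i).
Proof.
split=> [|x xZ|c x c0]; rewrite ?mxE //.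
rewrite (_ : (fun t => _) = (@tnth n L)^~ i); first exact: measurable_tnth.
by apply/funext => t; rewrite mxE.
Qed.

Lemma tropical0 n : tropical ((fun=> 0) : 'rV[R]_n -> R).
Proof. by split=> [|x _|c x _]; rewrite ?mulr0 ?rpred0. Qed.

Lemma tropicalD n (g h : 'rV[R]_n -> R) :
  tropical g -> tropical h -> tropical (fun x => g x + h x).
Proof.
move=> [mg gZ gc] [mh hZ hc]; split=> [|x xZ|c x c0].
- exact: measurable_funD.
- by rewrite rpredD ?gZ ?hZ.
- by rewrite gc// hc// mulrDr.
Qed.

Lemma tropicalN n (g : 'rV[R]_n -> R) :
  tropical g -> tropical (fun x => - g x).
Proof.
move=> [mg gZ gc]; split=> [|x xZ|c x c0].
- exact: measurable_funN.
- by rewrite rpredN gZ.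
- by rewrite gc// mulrN.
Qed.

Lemma tropical_max n (g h : 'rV[R]_n -> R) :
  tropical g -> tropical h -> tropical (fun x => Num.max (g x) (h x)).
Proof.
move=> [mg gZ gc] [mh hZ hc]; split=> [|x xZ|c x c0].
- exact: measurable_maxr.
- by rewrite /Num.max; case: ifP => _; rewrite ?gZ ?hZ.
- by rewrite gc// hc// maxr_pMr.
Qed.

Lemma tropical_sum n (I : Type) (s : seq I) (A : pred I) (F : I -> 'rV[R]_n -> R) :
  (forall i, tropical (F i)) -> tropical (fun x => \sum_(i <- s | A i) F i x).
Proof.
move=> tF; elim: s => [|i s IH].
  under eq_fun do rewrite big_nil; exact: tropical0.
under eq_fun do rewrite big_cons; case: (A i) => //; exact: tropicalD.
Qed.

Lemma tropical_bigmax n (I : Type) (s : seq I) (A : pred I) (F : I -> 'rV[R]_n -> R) :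
  (forall i, tropical (F i)) ->
  tropical (fun x => \big[Num.max/0]_(i <- s | A i) F i x).
Proof.
move=> tF; elim: s => [|i s IH].
  under eq_fun do rewrite big_nil; exact: tropical0.
under eq_fun do rewrite big_cons; case: (A i) => //; exact: tropical_max.
Qed.

Lemma measurable_tropical_le n (h : 'rV[R]_n -> R) (a : R) :
  tropical h -> measurable (tuple_set [set x | h x <= a]).
Proof.
move=> [mh _ _].
rewrite (_ : tuple_set _ = [set: n.-tuple L] `&`
    (fun t => h (\row_i tnth t i)) @^-1` `]-oo, a]%classic).
  by apply: mh => //; exact: measurable_itv.
by rewrite setTI; apply/seteqP; split=> t /=; rewrite in_itv.
Qed.

Definition lattice_preserving n (f : 'rV[R]_n -> 'rV[R]_n) :=
  [/\ forall X, measurable (tuple_set X) ->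
        measurable (tuple_set (f @^-1` X)) /\ volume (f @^-1` X) = volume X,
      forall x, lattice_point x -> lattice_point (f x) &
      forall c x, 0 <= c -> f (c *: x) = c *: f x].

Definition lattice_equivalence n (f g : 'rV[R]_n -> 'rV[R]_n) :=
  [/\ cancel f g, cancel g f, lattice_preserving f & lattice_preserving g].

Lemma lattice_preserving_comp n (f f' : 'rV[R]_n -> 'rV[R]_n) :
  lattice_preserving f -> lattice_preserving f' -> lattice_preserving (f \o f').
Proof.
move=> [mf fZ fc] [mf' fZ' fc']; split=> [X mX|x xZ|c x c0] /=.
- have [m1 v1] := mf X mX; have [m2 v2] := mf' _ m1.
  by rewrite comp_preimage; split=> //; rewrite v2.
- by apply/fZ/fZ'.
- by rewrite fc'// fc.
Qed.

Lemma lattice_equivalence_comp n (f g f' g' : 'rV[R]_n -> 'rV[R]_n) :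
  lattice_equivalence f g -> lattice_equivalence f' g' ->
  lattice_equivalence (f \o f') (g' \o g).
Proof.
move=> [fK gK pf pg] [fK' gK' pf' pg'].
by split; [exact: can_comp|exact: can_comp| |]; exact: lattice_preserving_comp.
Qed.

Lemma lattice_equivalence_id n : lattice_equivalence (@id 'rV[R]_n) id.
Proof. by split=> //; split=> // X mX; rewrite preimage_id. Qed.

Lemma volume_lattice_equivalence n (f g : 'rV[R]_n -> 'rV[R]_n) (A B : set 'rV[R]_n) :
  lattice_equivalence f g -> (forall x, A (f x) <-> B x) ->
  measurable (tuple_set B) -> volume A = volume B.
Proof.
move=> [fK gK _ [mg _ _]] AB mB; have [_ <-] := mg _ mB.
by congr volume; apply/seteqP; split=> x /=; rewrite -AB gK.
Qed.

(** Since [f] commutes with the dilation by m and preserves lattice points in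
    both directions, it restricts to a bijection between the lattice points of
    the m-th dilates.  If there are infinitely many of them, [fset_set] sends
    both sets to the empty set. *)
Lemma ehrhart_lattice_equivalence n (f g : 'rV[R]_n -> 'rV[R]_n)
    (A B : set 'rV[R]_n) m :
  lattice_equivalence f g -> (forall x, A (f x) <-> B x) ->
  ehrhart A m = ehrhart B m.
Proof.
move=> [fK gK [_ fZ fc] [_ gZ gc]] AB.
pose i (z : 'rV[int]_n) : 'rV[R]_n := map_mx intr z.
pose F (h : 'rV[R]_n -> 'rV[R]_n) z := map_mx Num.floor (h (i z)).
have iZ z : lattice_point (i z) by move=> k; rewrite mxE intr_int.
have iK : cancel i (map_mx Num.floor).
  by move=> z; apply/rowP => k; rewrite !mxE intrKfloor.
have iF h z : lattice_point (h (i z)) -> i (F h z) = h (i z).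
  by move=> hz; apply/rowP => k; rewrite !mxE floorK// (hz k).
have Fi : injective (F f).
  move=> y z /(congr1 i); rewrite !iF; [|exact/fZ..].
  by move=> /(can_inj fK)/(can_inj iK).
rewrite /ehrhart.
set ZA := [set z | _ (map_mx _ z)]; set ZB := [set z | _ (map_mx _ z)].
have ZE : ZA = F f @` ZB.
  apply/seteqP; split=> z /=.
    case=> x Ax xz; exists (F g z).
      rewrite /ZB /= -/(i _) iF; last exact/gZ.
      exists (g x); first by rewrite -AB gK.
      by rewrite -gc ?ler0n// xz.
    by rewrite /F -/(F g z) iF; [rewrite gK iK|exact/gZ].
  case=> y [x Bx xy] <-; rewrite /ZA /= -/(i _) iF; last exact/fZ.
  by exists (f x); [rewrite AB|rewrite -fc ?ler0n// xy].
have ZAB : (ZA #= ZB)%card by rewrite ZE; apply: inj_card_eq; exact: in2W.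
case: (pselect (finite_set ZB)) => fB.
  by apply/fcard_eq => //; rewrite (eq_finite_set ZAB).
have fA : ~ finite_set ZA by rewrite (eq_finite_set ZAB).
by rewrite /fset_set; case: pselect => //; case: pselect.
Qed.

Definition coord_shear n (i : 'I_n) (h : 'rV[R]_n -> R) (x : 'rV[R]_n) :=
  x + h x *: delta_mx ord0 i.

Lemma coord_shearE n (i : 'I_n) h (x : 'rV[R]_n) j :
  coord_shear i h x ord0 j = x ord0 j + (if j == i then h x else 0).
Proof. by rewrite !mxE eqxx /=; case: (j == i); rewrite (mulr1, mulr0). Qed.

Lemma lattice_preserving_shear n (i : 'I_n) (h : 'rV[R]_n -> R) :
  tropical h -> (forall x c, h (x + c *: delta_mx ord0 i) = h x) ->
  lattice_preserving (coord_shear i h).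
Proof.
move=> [mh hZ hc] hi; split=> [X mX|x xZ j|c x c0].
- pose g (t : n.-tuple L) := h (\row_i tnth t i).
  have E : tuple_set (coord_shear i h @^-1` X) = shear i g @^-1` (tuple_set X).
    apply/funext => t; rewrite /tuple_set /preimage /=; congr (X _).
    by apply/rowP => j; rewrite coord_shearE !mxE tnth_mktuple.
  split.
    rewrite E -[X in measurable X]setTI.
    exact: measurable_shear.
  rewrite /volume -/(tuple_set _) E; apply: lebesgue_tuple_shear => // t u tu.
  rewrite /g -(hi _ (tnth u i - tnth t i)); congr h; apply/rowP => j.
  rewrite !mxE /=; have [->|ji] := eqVneq j i; first by rewrite mulr1 addrC subrK.
  by rewrite mulr0 addr0 tu.
- by rewrite coord_shearE rpredD//; case: ifP => _; rewrite ?hZ ?rpred0.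
- by rewrite /coord_shear hc// scalerDr scalerA.
Qed.

(** The inverse subtracts [h], whose value the shear leaves unchanged because
    [h] ignores the sheared coordinate. *)
Lemma lattice_equivalence_shear n (i : 'I_n) (h : 'rV[R]_n -> R) :
  tropical h -> (forall x c, h (x + c *: delta_mx ord0 i) = h x) ->
  lattice_equivalence (coord_shear i h) (coord_shear i (fun x => - h x)).
Proof.
move=> th hi; split.
- by move=> x; rewrite /coord_shear hi -addrA -scalerDl subrr scale0r addr0.
- by move=> x; rewrite /coord_shear hi -addrA -scalerDl addNr scale0r addr0.
- exact: lattice_preserving_shear.
- by apply: lattice_preserving_shear; [exact: tropicalN|move=> x c; rewrite hi].
Qed.

(** Apply the shears of the coordinates one after another in increasing order
    of [pos].  When the turn of coordinate i comes, the coordinates that [h i]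
    reads still have their original values. *)
Lemma lattice_equivalence_triangular n (pos : 'I_n -> nat)
    (h : 'I_n -> 'rV[R]_n -> R) :
  injective pos -> (forall i, tropical (h i)) ->
  (forall i j x c, (pos j <= pos i)%N ->
     h i (x + c *: delta_mx ord0 j) = h i x) ->
  exists g, lattice_equivalence (fun x => x + \row_i h i x) g.
Proof.
move=> posI th hpos.
pose before i j := (pos i <= pos j)%N.
pose s := sort before (enum 'I_n).
have sP : pairwise (fun i j => pos i < pos j)%N s.
  suff : pairwise (fun i j => (i != j) && before i j) s.
    by apply: sub_pairwise => i j /andP[ij]; rewrite ltn_neqAle (inj_eq posI) ij.
  rewrite pairwise_relI -uniq_pairwise sort_uniq enum_uniq /=.
  rewrite -sorted_pairwise; last by move=> j i k; exact: leq_trans.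
  by apply: sort_sorted => i j; exact: leq_total.
suff [f [g [e fE]]] : exists f g, lattice_equivalence f g /\
    (forall x j, f x ord0 j = x ord0 j + (if j \in s then h j x else 0)).
  exists g; rewrite (_ : (fun x => _) = f)//.
  by apply/funext => x; apply/rowP => j; rewrite fE !mxE mem_sort mem_enum.
elim: s sP => [_|i s IH].
  exists id, id; split; first exact: lattice_equivalence_id.
  by move=> x j; rewrite addr0.
rewrite pairwise_cons => /andP[/allP is_ /IH[f [g [e fE]]]].
exists (f \o coord_shear i (h i)), (coord_shear i (fun x => - h i x) \o g); split.
  apply: lattice_equivalence_comp => //.
  by apply: lattice_equivalence_shear => // x c; rewrite hpos.
move=> x j; rewrite /= fE coord_shearE in_cons.
have [->|ji] /= := eqVneq j i.
  rewrite ifF ?addr0//; apply/negP => /is_; by rewrite ltnn.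
rewrite addr0; case: ifP => // /is_ ij.
by rewrite /coord_shear hpos// ltnW.
Qed.

End LatticeEquivalence.

(** * Convex hulls and pyramids *)

Section ConvexHulls.
Context {R : realType}.

(** Convexity with two explicit nonnegative weights, which avoids the bundled
    scalars of [convex_set]; see [convex_setP]. *)
Definition closed_under_mixing n (A : set 'rV[R]_n) :=
  forall x y a b, A x -> A y -> 0 <= a -> 0 <= b -> a + b = 1 ->
    A (a *: x + b *: y).

Lemma convex_setP n (A : set 'rV[R]_n) :
  @convex_set R 'rV[R]_n A <-> closed_under_mixing A.
Proof.
split=> [cA x y a b Ax Ay a0 b0 ab|cA x y t]; last first.
  rewrite !inE => Ax Ay; apply: cA => //.
    by rewrite subr_ge0.
  by rewrite addrC subrK.
have a1 : a <= 1 by rewrite -ab lerDl.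
have := cA x y (Itv01 a0 a1); rewrite !inE => /(_ Ax Ay).
by rewrite /Itv01 /= (_ : b = 1 - a)// -ab addrC addKr.
Qed.

Lemma conv_mixing n (A : set 'rV[R]_n) : closed_under_mixing (Defs.conv A).
Proof.
move=> x y a b Ax Ay a0 b0 ab B [cB AB].
by move/convex_setP: (cB); apply => //; [apply: Ax|apply: Ay].
Qed.

Lemma sub_conv n (A : set 'rV[R]_n) : A `<=` Defs.conv A.
Proof. exact: sub_gen_smallest. Qed.

Lemma conv_sub n (A B : set 'rV[R]_n) :
  closed_under_mixing B -> A `<=` B -> Defs.conv A `<=` B.
Proof. by move=> /convex_setP cB AB; exact: smallest_sub. Qed.

(** Convexity turned into a A + b A = (a + b) A by rescaling with a + b; when
    this is 0, both summands vanish. *)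
Lemma mixing_scaled_sum n (A : set 'rV[R]_n) x y a b :
  closed_under_mixing A -> A x -> A y -> 0 <= a -> 0 <= b ->
  exists2 z, A z & a *: x + b *: y = (a + b) *: z.
Proof.
move=> cA Ax Ay a0 b0; have := addr_ge0 a0 b0.
rewrite le_eqVlt => /orP[/eqP ab0|ab].
  exists x => //; move/esym/eqP: ab0; rewrite paddr_eq0// => /andP[/eqP -> /eqP ->].
  by rewrite addr0 !scale0r addr0.
exists ((a / (a + b)) *: x + (b / (a + b)) *: y).
  by apply: cA => //; rewrite ?divr_ge0 ?(ltW ab)// -mulrDl divff ?gt_eqF.
by rewrite scalerDr !scalerA ![_ * (_ / _)]mulrC !divfK ?gt_eqF.
Qed.

(** The differences a y - b z with a + b = 1 already form a convex set, by
    [mixing_scaled_sum] applied on each side; the origin is used to represent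
    the points of A and of -B themselves. *)
Lemma GammaP n (A B : set 'rV[R]_n) x :
  closed_under_mixing A -> closed_under_mixing B -> A 0 -> B 0 ->
  Gamma A B x <-> exists a b y z,
    [/\ 0 <= a, 0 <= b & a + b = 1] /\ [/\ A y, B z & x = a *: y - b *: z].
Proof.
move=> cA cB A0 B0; split; last first.
  move=> [a [b [y [z [[a0 b0 ab] [Ay Bz ->]]]]]].
  rewrite -scalerN; apply: conv_mixing => //; apply: sub_conv.
    by left.
  by right; exists z.
apply: (conv_sub (B := [set x | exists a b y z,
    [/\ 0 <= a, 0 <= b & a + b = 1] /\ [/\ A y, B z & x = a *: y - b *: z]]));
  last first.
  move=> t [At|[z Bz <-]].
    exists 1, 0, t, 0; split; first by rewrite addr0.
    by split; [by []|by []|rewrite scale1r scale0r subr0].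
  exists 0, 1, 0, z; split; first by rewrite add0r.
  by split => //; rewrite scale1r scale0r sub0r.
move=> x1 x2 s t [a [b [y [z [[a0 b0 ab] [Ay Bz ->]]]]]]
  [a' [b' [y' [z' [[a0' b0' ab'] [Ay' Bz' ->]]]]]] s0 t0 st.
have [y1 Ay1 Ey] := mixing_scaled_sum cA Ay Ay' (mulr_ge0 s0 a0) (mulr_ge0 t0 a0').
have [z1 Bz1 Ez] := mixing_scaled_sum cB Bz Bz' (mulr_ge0 s0 b0) (mulr_ge0 t0 b0').
exists (s * a + t * a'), (s * b + t * b'), y1, z1; split; first split.
- by rewrite addr_ge0 ?mulr_ge0.
- by rewrite addr_ge0 ?mulr_ge0.
- by rewrite addrACA -!mulrDr ab ab' !mulr1.
split => //.
by rewrite -Ey -Ez !scalerBr !scalerA opprD addrACA.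
Qed.

Definition pyramid n (A : set 'rV[R]_n) : set 'rV[R]_n.+1 :=
  [set s *: lift_height x 1 | s in [set s : R | 0 <= s <= 1] & x in A].

Lemma lift_height_max n (x : 'rV[R]_n) t : lift_height x t ord0 ord_max = t.
Proof. by rewrite mxE unlift_none. Qed.

Lemma lift_height_lift n (x : 'rV[R]_n) t j :
  lift_height x t ord0 (lift ord_max j) = x ord0 j.
Proof. by rewrite mxE liftK. Qed.

Lemma rowP_lift_max n (x y : 'rV[R]_n.+1) :
  x ord0 ord_max = y ord0 ord_max ->
  (forall j, x ord0 (lift ord_max j) = y ord0 (lift ord_max j)) -> x = y.
Proof.
move=> xym xyl; apply/rowP => i.
by case: (unliftP ord_max i) => [j ->|->].
Qed.

(** The base of a pyramid lies in the pyramid, which gives one inclusion.  For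
    the other one, Omega contains the two bases and, as the midpoint of (0, 1)
    and (0, -1), the common apex 0. *)
Lemma Omega_pyramid n (A B : set 'rV[R]_n) : A 0 -> B 0 ->
  Omega A B = Gamma (pyramid A) (pyramid B).
Proof.
move=> A0 B0.
have hN (x : 'rV[R]_n) : lift_height (- x) (- 1) = - lift_height x 1.
  by apply: rowP_lift_max => [|j];
    rewrite ![(- lift_height _ _) _ _]mxE ?lift_height_max// !lift_height_lift mxE.
apply/seteqP; split; apply: conv_sub; try exact: conv_mixing.
  move=> _ [[x Ax <-]|[y By <-]]; apply: sub_conv; [left|right].
    by exists 1; [rewrite /= ler01 lexx|exists x; rewrite ?scale1r].
  exists (lift_height y 1); last by rewrite hN.
  by exists 1; [rewrite /= ler01 lexx|exists y; rewrite ?scale1r].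
have O0 : Omega A B 0.
  have -> : 0 = 2^-1 *: lift_height (0 : 'rV[R]_n) 1 + 2^-1 *: - lift_height 0 1.
    by rewrite scalerN subrr.
  apply: conv_mixing; rewrite ?invr_ge0//; last by field.
    by apply: sub_conv; left; exists 0.
  by apply: sub_conv; right; exists 0; rewrite // -hN oppr0.
have mix s (x : 'rV[R]_n.+1) : 0 <= s <= 1 -> Omega A B x -> Omega A B (s *: x).
  move=> /andP[s0 s1] Ox; rewrite -[_ *: _]addr0 -(scaler0 _ (1 - s)).
  by apply: conv_mixing; rewrite // ?subr_ge0// addrC subrK.
move=> _ [[s s01 [x Ax <-]]|[_ [s s01 [y By <-]] <-]].
  by apply: mix => //; apply: sub_conv; left; exists x.
rewrite -scalerN -hN; apply: mix => //; apply: sub_conv; right; by exists y.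
Qed.

End ConvexHulls.

(** * Heaviest chains *)

Section HeaviestChain.
Context {R : realType} {disp : Order.disp_t} {P : finPOrderType disp} {n : nat}.
Variable p : 'I_n -> P.
Implicit Types (C D : {set P}) (y z : 'I_n -> R).

Definition weight y C : R := \sum_(i | p i \in C) y i.

Definition heaviest D y : R :=
  \big[Num.max/0]_(C : {set P} | is_chain C && (C \subset D)) weight y C.

Lemma is_chainP C :
  reflect {in C &, forall x y : P, (x >=< y)%O} (is_chain C).
Proof.
apply: (iffP 'forall_in_forall_inP) => [H x y xC yC|H x xC y yC]; exact: H.
Qed.

Lemma weight_le_heaviest C D y :
  is_chain C -> C \subset D -> weight y C <= heaviest D y.
Proof. by move=> cC CD; apply: le_bigmax_cond; rewrite cC. Qed.

Lemma heaviest_ge0 D y : 0 <= heaviest D y.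
Proof. exact: bigmax_ge_id. Qed.

Lemma heaviest_leP D y a : 0 <= a ->
  (forall C, is_chain C -> C \subset D -> weight y C <= a) <->
  heaviest D y <= a.
Proof.
move=> a0; split=> [H|H C cC CD].
  by apply: bigmax_le => // C /andP[cC CD]; exact: H.
by apply: le_trans H; exact: weight_le_heaviest.
Qed.

Lemma eq_heaviest D y z :
  (forall i, p i \in D -> y i = z i) -> heaviest D y = heaviest D z.
Proof.
move=> yz; apply: eq_bigr => C /andP[_ /fintype.subsetP CD].
by apply: eq_bigr => i iC; apply/yz/CD.
Qed.

Lemma heaviest_le D y z :
  (forall i, p i \in D -> y i <= z i) -> heaviest D y <= heaviest D z.
Proof.
move=> yz; apply/heaviest_leP => [|C cC CD]; first exact: heaviest_ge0.
apply: le_trans (weight_le_heaviest z cC CD).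
by apply: ler_sum => i iC; apply/yz/(fintype.subsetP CD).
Qed.

Lemma heaviestZ D y c : 0 <= c -> heaviest D (fun i => c * y i) = c * heaviest D y.
Proof.
move=> c0; rewrite /heaviest.
rewrite (@big_morph _ _ ( *%R c) 0 Num.max 0 Num.max) ?mulr0//; last first.
  by move=> a b; rewrite maxr_pMr.
by apply: eq_bigr => C _; rewrite /weight mulr_sumr.
Qed.

Lemma tropical_heaviest D m (F : 'I_n -> 'rV[R]_m -> R) :
  (forall i, tropical (F i)) -> tropical (fun x => heaviest D (fun i => F i x)).
Proof.
by move=> tF; apply: tropical_bigmax => C; exact: tropical_sum.
Qed.

Definition above i : {set P} := [set x | (p i < x)%O].

Hypothesis p_inj : injective p.

Lemma weight_setU1 j C y : p j \notin C -> weight y (p j |: C) = y j + weight y C.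
Proof.
move=> jC; rewrite /weight (bigD1 j) ?finset.setU11//=; congr (_ + _).
apply: eq_bigl => i; rewrite finset.in_setU1 (inj_eq p_inj).
by have [->|ij] //= := eqVneq i j; rewrite ?andbT// (negPf jC).
Qed.

(** Putting element j below a chain of elements above it gives a chain. *)
Lemma heaviest_step D y j : p j \in D -> above j \subset D ->
  y j + heaviest (above j) y <= heaviest D y.
Proof.
move=> jD sD; rewrite -lerBrDl.
have chain_step C : is_chain C -> C \subset above j ->
    y j + weight y C <= heaviest D y.
  move=> /is_chainP cC /fintype.subsetP Cj.
  have lt_j x : x \in C -> (p j < x)%O by move/Cj; rewrite inE.
  rewrite -weight_setU1; last by apply/negP => /lt_j; rewrite ltxx.
  apply: weight_le_heaviest; last first.
    by rewrite finset.subUset finset.sub1set jD (fintype.subset_trans _ sD)//;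
      apply/fintype.subsetP.
  apply/is_chainP => x z /finset.setU1P[->|xC] /finset.setU1P[->|zC]; last exact: cC.
  - by rewrite comparablexx.
  - by rewrite lt_comparable ?lt_j.
  - by rewrite comparable_sym lt_comparable ?lt_j.
apply/heaviest_leP => [|C cC Cj]; last by rewrite lerBrDl chain_step.
rewrite subr_ge0 -[y j]addr0.
have w0 : weight y finset.set0 = 0 by rewrite /weight big_pred0// => i; rewrite inE.
by rewrite -w0 chain_step ?finset.sub0set//; apply/is_chainP => x z; rewrite inE.
Qed.

(** A nonempty chain in [D] has a least element j, and what remains of it after
    removing j lies above j.  The least element is found as the one with the
    fewest elements of the poset below it. *)
Lemma heaviest_bottom_le D y a : 0 <= a ->
  (forall j, p j \in D -> y j + heaviest (above j) y <= a) -> heaviest D y <= a.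
Proof.
move=> a0 Ha; apply/heaviest_leP => // C /is_chainP cC /fintype.subsetP CD.
case: (pickP (fun i => p i \in C)) => [i0 i0C|C0]; last first.
  by rewrite /weight big_pred0.
case: (@arg_minnP _ i0 (fun i => p i \in C)
  (fun i => #|finset (fun x => (x < p i)%O)|) i0C) => j jC jmin.
have ge_j i : p i \in C -> (p j <= p i)%O.
  move=> iC; have /orP[//|] := cC _ _ jC iC.
  rewrite le_eqVlt => /orP[/eqP -> //|ij].
  have := jmin i iC; rewrite leqNgt => /negP[]; apply: proper_card.
  apply/properP; split; first by apply/fintype.subsetP => x; rewrite !inE => /lt_trans; exact.
  by exists (p i); rewrite !inE ?ltxx.
apply: le_trans (Ha j (CD _ jC)).
rewrite -(finset.setD1K jC) weight_setU1 ?finset.setD11// lerD2l.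
rewrite /weight (eq_bigl (fun i => p i \in (C :\ p j) :&: above j)); last first.
  move=> i; rewrite !inE; case: eqVneq => //= ij; case: (boolP (p i \in C)) => //= iC.
  by rewrite lt_neqAle eq_sym ij ge_j.
apply: weight_le_heaviest; last exact: finset.subsetIr.
apply/is_chainP => x z; rewrite !inE => /andP[/andP[_ xC] _] /andP[/andP[_ zC] _].
exact: cC.
Qed.

Lemma coord_le_heaviest y i : (forall j, 0 <= y j) -> y i <= heaviest [set: P] y.
Proof.
move=> y0; apply: le_trans (heaviest_step _ (j := i) _ _); rewrite ?inE ?finset.subsetT//.
by rewrite lerDl heaviest_ge0.
Qed.

End HeaviestChain.

(** * Transfer maps and the common body *)

Section Transfer.
Context {R : realType} {n : nat}.

(** The map y |-> y + U(y) carries { y >= 0 | heaviest y <= 1 } into [B]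
    ([transfer_into]).  The last two fields say that it is minimal.  If
    y + U(y) is bounded by a point of the dilate a B, then y has weight at most
    a ([transfer_weight]).  And a bound by such a point on the coordinates
    above i already bounds the offset at i ([transfer_offset]), which is the
    induction step of [untransfer_minimal]. *)
Record transfer {disp : Order.disp_t} {P : finPOrderType disp} (p : 'I_n -> P)
    (U : 'I_n -> ('I_n -> R) -> R) (B : set 'rV[R]_n) : Prop := Transfer {
  transfer_mixing : closed_under_mixing B;
  transfer_origin : B 0;
  transfer_local : forall i y z,
    (forall j, (p i < p j)%O -> y j = z j) -> U i y = U i z;
  transfer_tropical : forall i m (F : 'I_n -> 'rV[R]_m -> R),
    (forall j, tropical (F j)) -> tropical (fun x => U i (fun j => F j x));
  transfer_into : forall y, (forall i, 0 <= y i) -> heaviest p [set: P] y <= 1 ->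
    B (\row_i (y i + U i y));
  transfer_weight : forall y v a, (forall i, 0 <= y i) -> B v -> 0 <= a ->
    (forall i, y i + U i y <= a * v ord0 i) -> heaviest p [set: P] y <= a;
  transfer_offset : forall y v a i, (forall i, 0 <= y i) -> B v -> 0 <= a ->
    (forall j, (p i < p j)%O -> y j + U j y <= a * v ord0 j) ->
    U i y <= a * v ord0 i }.

Lemma transferZ {disp : Order.disp_t} {P : finPOrderType disp} (p : 'I_n -> P)
    U B : transfer p U B -> forall i c y, 0 <= c ->
  U i (fun j => c * y j) = c * U i y.
Proof.
move=> tU i c y c0.
have [_ _ /(_ c (\row_j y j) c0) /= UZ] :=
  transfer_tropical tU i (fun j => tropical_coord j).
have rowE : (fun j => (\row_j y j) ord0 j) = y by apply/funext => j; rewrite mxE.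
rewrite -[in RHS]rowE -UZ; congr (U i _).
by apply/funext => j; rewrite !mxE.
Qed.

(** [transfer_into] for dilates.  For a > 0 this is homogeneity; for a = 0 the
    weighting vanishes, being bounded coordinatewise by its heaviest chain. *)
Lemma transfer_scaled {disp : Order.disp_t} {P : finPOrderType disp}
    (p : 'I_n -> P) U B y a : injective p -> transfer p U B ->
  (forall i, 0 <= y i) -> 0 <= a -> heaviest p [set: P] y <= a ->
  exists2 v, B v & \row_i (y i + U i y) = a *: v.
Proof.
move=> p_inj tU y0; rewrite le_eqVlt => /orP[/eqP <-|a0] ya.
  have yE : y = (fun i => 0 * y i).
    apply/funext => i; apply/eqP; rewrite mul0r eq_le y0 andbT.
    exact: le_trans (coord_le_heaviest p_inj i y0) ya.
  exists 0; first exact: transfer_origin tU.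
  apply/rowP => i; rewrite scale0r !mxE [in U _ _]yE (transferZ tU)// mul0r addr0.
  by rewrite yE mul0r.
have a'0 : 0 <= a^-1 by rewrite invr_ge0 ltW.
exists (a^-1 *: \row_i (y i + U i y)); last by rewrite scalerA divff ?gt_eqF ?scale1r.
have -> : a^-1 *: \row_i (y i + U i y) =
    \row_i ((a^-1 * y i) + U i (fun j => a^-1 * y j)).
  by apply/rowP => i; rewrite !mxE (transferZ tU)// mulrDr.
apply: (transfer_into tU) => [i|]; first exact: mulr_ge0.
by rewrite heaviestZ// mulrC ler_pdivrMr// mul1r.
Qed.

Definition pos_part (w : 'rV[R]_n) i : R := Num.max 0 (w ord0 i).
Definition neg_part (w : 'rV[R]_n) i : R := Num.max 0 (- w ord0 i).

Lemma pos_part_ge0 (w : 'rV[R]_n) i : 0 <= pos_part w i.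
Proof. by rewrite le_max lexx. Qed.

Lemma neg_part_ge0 (w : 'rV[R]_n) i : 0 <= neg_part w i.
Proof. by rewrite le_max lexx. Qed.

Lemma pos_partBneg (w : 'rV[R]_n) i : w ord0 i = pos_part w i - neg_part w i.
Proof.
rewrite /pos_part /neg_part; case: (leP 0 (w ord0 i)) => w0.
  by rewrite max_l ?oppr_le0// subr0.
by rewrite max_r ?oppr_ge0 ?(ltW w0)// opprK add0r.
Qed.

Lemma pos_or_neg_part0 (w : 'rV[R]_n) i : pos_part w i = 0 \/ neg_part w i = 0.
Proof.
rewrite /pos_part /neg_part; case: (leP 0 (w ord0 i)) => w0; last by left.
by right; rewrite max_l ?oppr_le0.
Qed.

Lemma tropical_pos_part i : tropical (fun w => pos_part w i).
Proof. by apply: tropical_max; [exact: tropical0|exact: tropical_coord]. Qed.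

Lemma tropical_neg_part i : tropical (fun w => neg_part w i).
Proof.
apply: tropical_max; first exact: tropical0.
by apply: tropicalN; exact: tropical_coord.
Qed.

Context {dP dQ : Order.disp_t} {P : finPOrderType dP} {Q : finPOrderType dQ}.
Variables (p : 'I_n -> P) (q : 'I_n -> Q).

(** For chain polytopes B and C of [p] and [q] this is Gamma(B, C) itself. *)
Definition weight_ball : set 'rV[R]_n :=
  [set w | heaviest p [set: P] (pos_part w) + heaviest q [set: Q] (neg_part w) <= 1].

Lemma measurable_weight_ball : measurable (tuple_set weight_ball).
Proof.
apply: measurable_tropical_le; apply: tropicalD; apply: tropical_heaviest.
  exact: tropical_pos_part.
exact: tropical_neg_part.
Qed.

Variables (U V : 'I_n -> ('I_n -> R) -> R) (B C : set 'rV[R]_n).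
Hypotheses (p_inj : injective p) (q_inj : injective q).
Hypotheses (tU : transfer p U B) (tV : transfer q V C).
Variable pos : 'I_n -> nat.
Hypotheses (pos_inj : injective pos)
  (pos_p : forall i j, (p i < p j)%O -> (pos i < pos j)%N)
  (pos_q : forall i j, (q i < q j)%O -> (pos i < pos j)%N).

(** As w is the difference of its positive and negative parts, this is
    (w+ + U(w+)) - (w- + V(w-)); see [untransferE]. *)
Definition untransfer (w : 'rV[R]_n) : 'rV[R]_n :=
  w + \row_i (U i (pos_part w) - V i (neg_part w)).

(** [U] looks up along P and [V] along Q, while [pos] increases along both: the
    map is triangular for [pos]. *)
Lemma untransfer_equivalence : exists g, lattice_equivalence untransfer g.
Proof.
apply: (lattice_equivalence_triangular pos_inj) => [i|i j x c ij].
  apply: tropicalD; first exact/(transfer_tropical tU)/tropical_pos_part.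
  by apply: tropicalN; exact/(transfer_tropical tV)/tropical_neg_part.
have off k : (pos i < pos k)%N -> (x + c *: delta_mx ord0 j) ord0 k = x ord0 k.
  move=> ik; rewrite !mxE eqxx /=; case: eqVneq => [kj|]; last by rewrite mulr0 addr0.
  by move: ik; rewrite kj ltnNge ij.
congr (_ - _); [apply: (transfer_local tU)|apply: (transfer_local tV)] => k ik.
  by rewrite /pos_part off// pos_p.
by rewrite /neg_part off// pos_q.
Qed.

Lemma untransferE w i : untransfer w ord0 i =
  (pos_part w i + U i (pos_part w)) - (neg_part w i + V i (neg_part w)).
Proof. by rewrite !mxE [w _ _]pos_partBneg opprD addrACA. Qed.

(** Downward induction along [pos].  Both offsets at i are bounded by the bounds
    on later coordinates.  One of w+_i and w-_i is 0, so on that side the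
    offset is the whole coordinate; on the other side the bound follows since
    both decompositions have the same difference. *)
Lemma untransfer_minimal w a b x y : 0 <= a -> 0 <= b -> B x -> C y ->
  untransfer w = a *: x - b *: y -> forall i,
  pos_part w i + U i (pos_part w) <= a * x ord0 i /\
  neg_part w i + V i (neg_part w) <= b * y ord0 i.
Proof.
move=> a0 b0 Bx Cy wE i.
have [m] := ubnP (\max_j pos j - pos i)%N; elim: m i => // m IH i im.
have IHi j : (pos i < pos j)%N ->
    pos_part w j + U j (pos_part w) <= a * x ord0 j /\
    neg_part w j + V j (neg_part w) <= b * y ord0 j.
  move=> ij; apply: IH; apply: leq_trans (im : (_ - _ <= m)%N).
  apply: ltn_sub2l => //; apply: leq_trans ij _; exact: leq_bigmax.
have Ui : U i (pos_part w) <= a * x ord0 i.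
  apply: (transfer_offset tU) => // [j|j /pos_p/IHi[]//]; exact: pos_part_ge0.
have Vi : V i (neg_part w) <= b * y ord0 i.
  apply: (transfer_offset tV) => // [j|j /pos_q/IHi[]//]; exact: neg_part_ge0.
move/rowP/(_ i): wE; rewrite untransferE !mxE => wE.
by case: (pos_or_neg_part0 w i) wE => ->; lra.
Qed.

(** Given a decomposition a x - b y of the image of w, minimality bounds the
    weights of w+ and w- by a and b.  Conversely take a to be the weight of w+
    and b = 1 - a. *)
Lemma Gamma_untransfer w : Gamma B C (untransfer w) <-> weight_ball w.
Proof.
rewrite GammaP; [|exact: transfer_mixing tU|exact: transfer_mixing tV
  |exact: transfer_origin tU|exact: transfer_origin tV].
split=> [[a [b [x [y [[a0 b0 ab] [Bx Cy wE]]]]]]|wB].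
  have min := untransfer_minimal a0 b0 Bx Cy wE.
  rewrite /weight_ball /= -ab; apply: lerD.
    apply: (transfer_weight tU (v := x)) => // i; first exact: pos_part_ge0.
    by case: (min i).
  apply: (transfer_weight tV (v := y)) => // i; first exact: neg_part_ge0.
  by case: (min i).
pose a := heaviest p [set: P] (pos_part w).
have a0 : 0 <= a by exact: heaviest_ge0.
have ba : heaviest q [set: Q] (neg_part w) <= 1 - a by rewrite lerBrDl.
have b0 : 0 <= 1 - a by apply: le_trans ba; exact: heaviest_ge0.
have [x Bx xE] := transfer_scaled p_inj tU (pos_part_ge0 w) a0 (lexx _).
have [y Cy yE] := transfer_scaled q_inj tV (neg_part_ge0 w) b0 ba.
exists a, (1 - a), x, y; split; first by split; rewrite // addrC subrK.
split => //; rewrite -xE -yE; apply/rowP => i.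
by rewrite untransferE !mxE.
Qed.

Lemma ehrhart_volume_Gamma :
  (forall m, ehrhart (Gamma B C) m = ehrhart weight_ball m) /\
  volume (Gamma B C) = volume weight_ball.
Proof.
have [g eg] := untransfer_equivalence; split=> [m|].
  exact: ehrhart_lattice_equivalence eg Gamma_untransfer.
exact: volume_lattice_equivalence eg Gamma_untransfer measurable_weight_ball.
Qed.

End Transfer.

(** * Order and chain polytopes *)

Section OrderChainTransfers.
Context {R : realType} {disp : Order.disp_t} {P : finPOrderType disp} {n : nat}.
Variable p : 'I_n -> P.
Hypothesis p_inj : injective p.

(** Stanley's transfer map.  Minimality: a point of a dilated order polytope
    decreases along P, so its value at i dominates its values at all elements
    j above i, hence every chain above i, by looking at the least element of
    that chain. *)
Lemma order_polytope_transfer :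
  transfer p (fun i => heaviest p (above p i)) (@order_polytope R _ P n p).
Proof.
split.
- move=> x y a b [x01 xp] [y01 yp] a0 b0 ab; split=> [i|i j ij]; rewrite !mxE.
    have /andP[? ?] := x01 i; have /andP[? ?] := y01 i.
    rewrite addr_ge0 ?mulr_ge0//= -ab -[X in _ <= X + _]mulr1 -[X in _ <= _ + X]mulr1.
    by rewrite lerD ?ler_wpM2l.
  by rewrite lerD ?ler_wpM2l ?xp ?yp.
- by split=> [i|i j _]; rewrite !mxE ?lexx ?ler01.
- by move=> i y z yz; apply: eq_heaviest => j; rewrite inE; exact: yz.
- by move=> i m F tF; exact: tropical_heaviest.
- move=> y y0 y1; split=> [i|i j]; rewrite !mxE.
    rewrite addr_ge0 ?heaviest_ge0//=; apply: le_trans y1.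
    by apply: heaviest_step => //; rewrite ?inE ?finset.subsetT.
  rewrite le_eqVlt => /orP[/eqP/p_inj-> //|ij].
  apply: (@le_trans _ _ (heaviest p (above p i) y)); last by rewrite lerDr.
  apply: heaviest_step; rewrite ?inE//.
  by apply/fintype.subsetP => x; rewrite !inE; exact: lt_trans.
- move=> y v a y0 [v01 _] a0 yv; apply: heaviest_bottom_le => // j _.
  apply: le_trans (yv j) _; have /andP[_ v1] := v01 j.
  by rewrite -[leRHS]mulr1 ler_wpM2l.
- move=> y v a i y0 [v01 vp] a0 yv; have /andP[v0 _] := v01 i.
  apply: heaviest_bottom_le => // [|j]; first exact: mulr_ge0.
  rewrite inE => ij; apply: le_trans (yv j ij) _.
  by rewrite ler_wpM2l// vp// ltW.
Qed.

(** For nonnegative coordinates a chain weighs at most as much as a maximal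
    chain containing it. *)
Lemma chain_polytopeP (x : 'rV[R]_n) : chain_polytope p x <->
  (forall i, 0 <= x ord0 i) /\ heaviest p [set: P] (fun i => x ord0 i) <= 1.
Proof.
split=> -[x0 x1]; split=> //; last first.
  move=> C /maxsetP[cC _]; apply: le_trans x1.
  exact: (weight_le_heaviest p (fun i => x ord0 i) cC (finset.subsetT _)).
apply/heaviest_leP => // C cC _.
have [D mD CD] := maxset_exists cC; apply: le_trans (x1 D mD).
rewrite [leRHS](bigID (fun i => p i \in C)) /=.
rewrite (eq_bigl (fun i => p i \in C)) ?lerDl ?sumr_ge0// => i.
by apply: andb_idl; exact: (fintype.subsetP CD).
Qed.

Lemma mixing_heaviest_le (D : {set P}) (x y : 'I_n -> R) a b s t :
  0 <= a -> 0 <= b -> heaviest p D x <= s -> heaviest p D y <= t ->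
  heaviest p D (fun i => a * x i + b * y i) <= a * s + b * t.
Proof.
move=> a0 b0 xs yt.
have s0 : 0 <= s by apply: le_trans xs; exact: heaviest_ge0.
have t0 : 0 <= t by apply: le_trans yt; exact: heaviest_ge0.
apply/heaviest_leP => [|C cC CD]; first by rewrite addr_ge0 ?mulr_ge0.
rewrite /weight big_split /= -!mulr_sumr lerD// ler_wpM2l//.
  by apply: le_trans xs; exact: weight_le_heaviest.
by apply: le_trans yt; exact: weight_le_heaviest.
Qed.

Lemma chain_polytope_transfer :
  transfer p (fun _ _ => 0) (@chain_polytope R _ P n p).
Proof.
split.
- move=> x y a b /chain_polytopeP[x0 x1] /chain_polytopeP[y0 y1] a0 b0 ab.
  apply/chain_polytopeP; split=> [i|]; first by rewrite !mxE addr_ge0 ?mulr_ge0.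
  under [X in heaviest _ _ X]eq_fun do rewrite !mxE.
  by rewrite -ab -[a in leRHS]mulr1 -[b in leRHS]mulr1; exact: mixing_heaviest_le.
- apply/chain_polytopeP; split=> [i|]; first by rewrite mxE.
  under [X in heaviest _ _ X]eq_fun do rewrite mxE.
  by apply/heaviest_leP => // C _ _; rewrite /weight big1.
- by [].
- by move=> i m F tF; exact: tropical0.
- move=> y y0 y1; apply/chain_polytopeP.
  under [X in heaviest _ _ X]eq_fun do rewrite mxE addr0.
  by split=> // i; rewrite mxE addr0.
- move=> y v a y0 /chain_polytopeP[v0 v1] a0 yv.
  rewrite -[leRHS]mulr1; apply: le_trans (ler_wpM2l a0 v1).
  rewrite -heaviestZ//; apply: heaviest_le => i _.
  by have := yv i; rewrite addr0.
- by move=> y v a i y0 /chain_polytopeP[v0 v1] a0 _; rewrite mulr_ge0.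
Qed.

End OrderChainTransfers.

(** * Adjoining a bottom element *)

Section Bottom.
Context {R : realType} {disp : Order.disp_t} {P : finPOrderType disp} {d : nat}.
Variable p : 'I_d -> P.
Let p' := add_bottom p.
Hypothesis p_inj : injective p.

Lemma add_bottom_max : p' ord_max = inl ord0.
Proof. by rewrite /p' /add_bottom unlift_none. Qed.

Lemma add_bottom_lift j : p' (lift ord_max j) = inr (p j).
Proof. by rewrite /p' /add_bottom liftK. Qed.

Lemma add_bottom_inj : injective p'.
Proof.
move=> i j; case: (unliftP ord_max i) => [i' ->|->];
  case: (unliftP ord_max j) => [j' ->|->];
  by rewrite ?add_bottom_max ?add_bottom_lift// => -[/p_inj ->].
Qed.

Lemma lt_inr (x y : P) : ((inr x : ordsum 'I_1 P) < inr y)%O = (x < y)%O.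
Proof. by rewrite !lt_neqAle. Qed.

Lemma lt_inl_inr (x : 'I_1) (y : P) : ((inl x : ordsum 'I_1 P) < inr y)%O.
Proof. by rewrite lt_neqAle. Qed.

Lemma lt_inr_inl (x : P) (y : 'I_1) : ((inr x : ordsum 'I_1 P) < inl y)%O = false.
Proof. by rewrite lt_neqAle andbF. Qed.

Lemma lt_inl (x y : 'I_1) : ((inl x : ordsum 'I_1 P) < inl y)%O = false.
Proof. by rewrite !(ord1 x, ord1 y) ltxx. Qed.

(** Stated for weights avoiding the bottom element, which are those occurring
    in chains strictly above it. *)
Lemma weight_add_bottom (y : 'I_d.+1 -> R) (C : {set ordsum 'I_1 P}) :
  inl ord0 \notin C ->
  weight p' y C = weight p (y \o lift ord_max) (inr @^-1: C).
Proof.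
move=> C0; rewrite /weight big_mkcond (bigD1_ord ord_max)//= add_bottom_max (negPf C0).
rewrite add0r [RHS]big_mkcond; apply: eq_bigr => j _.
by rewrite add_bottom_lift inE.
Qed.

Lemma heaviest_add_bottom (y : 'I_d.+1 -> R) :
  heaviest p' (above p' ord_max) y = heaviest p [set: P] (y \o lift ord_max).
Proof.
apply/eqP; rewrite eq_le; apply/andP; split.
  apply/heaviest_leP => [|C /is_chainP cC /fintype.subsetP CD].
    exact: heaviest_ge0.
  rewrite weight_add_bottom; last first.
    by apply/negP => /CD; rewrite inE add_bottom_max ltxx.
  apply: weight_le_heaviest; last exact: finset.subsetT.
  by apply/is_chainP => x z; rewrite !inE => xC zC; exact: (cC _ _ xC zC).
apply/heaviest_leP => [|C /is_chainP cC _]; first exact: heaviest_ge0.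
pose D : {set ordsum 'I_1 P} := (fun x : P => inr x : ordsum 'I_1 P) @: C.
have -> : C = inr @^-1: D.
  by apply/finset.setP => x; rewrite inE mem_imset//; move=> ? ? [].
rewrite -weight_add_bottom; last by apply/negP => /imsetP[].
apply: weight_le_heaviest.
  by apply/is_chainP => _ _ /imsetP[x xC ->] /imsetP[z zC ->]; exact: (cC _ _ xC zC).
by apply/fintype.subsetP => _ /imsetP[x xC ->]; rewrite inE add_bottom_max lt_inl_inr.
Qed.

Lemma pyramidP (A : set 'rV[R]_d) (z : 'rV[R]_d.+1) : pyramid A z <->
  0 <= z ord0 ord_max <= 1 /\
  exists2 x, A x & forall j, z ord0 (lift ord_max j) = z ord0 ord_max * x ord0 j.
Proof.
split=> [[s s01 [x Ax <-]]|[z01 [x Ax zx]]].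
  rewrite mxE lift_height_max mulr1; split=> //.
  by exists x => // j; rewrite mxE lift_height_lift.
exists (z ord0 ord_max) => //; exists x => //.
apply: rowP_lift_max => [|j]; rewrite mxE ?lift_height_max ?mulr1//.
by rewrite lift_height_lift zx.
Qed.

(** In O_P' the bottom coordinate s dominates all others, so dividing them by
    s gives a point of O_P; if s = 0 the point is the apex. *)
Lemma pyramid_order_polytope :
  pyramid (order_polytope p) = order_polytope p' :> set 'rV[R]_d.+1.
Proof.
apply/seteqP; split=> z.
  move=> /pyramidP[/andP[z0 z1] [x [x01 xp] zx]]; split=> [i|i j].
    case: (unliftP ord_max i) => [k ->|->]; last by rewrite z0.
    have /andP[x0 x1] := x01 k.
    by rewrite zx mulr_ge0//= mulr_ile1.
  case: (unliftP ord_max i) => [i' ->|->]; case: (unliftP ord_max j) => [j' ->|->].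
  - by rewrite !add_bottom_lift !zx => ij; rewrite ler_wpM2l// xp.
  - by rewrite add_bottom_lift add_bottom_max.
  - have /andP[x0 x1] := x01 j'.
    by move=> _; rewrite zx -[leRHS]mulr1 ler_wpM2l.
  - by [].
move=> [z01 zp]; apply/pyramidP; split; first exact: z01.
have zmax j : z ord0 (lift ord_max j) <= z ord0 ord_max.
  by apply: zp; rewrite add_bottom_max add_bottom_lift.
have /andP[z0 _] := z01 ord_max.
have [zm0|zm0] := eqVneq (z ord0 ord_max) 0.
  exists 0; first by split=> [i|i j _]; rewrite !mxE ?lexx ?ler01.
  move=> j; rewrite mxE mulr0; apply/eqP; rewrite eq_le -zm0 zmax zm0.
  by have /andP[] := z01 (lift ord_max j).
have zm : 0 < z ord0 ord_max by rewrite lt_neqAle eq_sym zm0.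
exists (\row_j (z ord0 (lift ord_max j) / z ord0 ord_max)); last first.
  by move=> j; rewrite mxE mulrC divfK.
split=> [i|i j ij]; rewrite !mxE.
  have /andP[? _] := z01 (lift ord_max i).
  by rewrite divr_ge0//= ler_pdivrMr// mul1r.
by rewrite ler_pM2r ?invr_gt0// zp// !add_bottom_lift.
Qed.

Lemma pyramid_chain_polytopeP (z : 'rV[R]_d.+1) : pyramid (chain_polytope p) z <->
  [/\ forall i, 0 <= z ord0 i, z ord0 ord_max <= 1 &
      heaviest p' (above p' ord_max) (fun i => z ord0 i) <= z ord0 ord_max].
Proof.
rewrite heaviest_add_bottom.
split=> [/pyramidP[/andP[z0 z1] [x /chain_polytopeP[x0 x1] zx]]|[z0 z1 zm]].
  split=> // [i|].
    by case: (unliftP ord_max i) => [j ->|->//]; rewrite zx mulr_ge0.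
  rewrite (_ : _ \o _ = fun j => z ord0 ord_max * x ord0 j); last first.
    by apply/funext => j /=; rewrite zx.
  by rewrite heaviestZ// -[leRHS]mulr1 ler_wpM2l.
apply/pyramidP; split; first by rewrite z0.
have [zm0|zm0] := eqVneq (z ord0 ord_max) 0.
  exists 0; first exact: transfer_origin (chain_polytope_transfer p).
  move=> j; rewrite mxE mulr0; apply/eqP; rewrite eq_le z0 andbT -zm0.
  apply: le_trans zm.
  by apply: (coord_le_heaviest p_inj (y := (fun i => z ord0 i) \o lift ord_max) j) => k; exact: z0.
have zm_gt0 : 0 < z ord0 ord_max by rewrite lt_neqAle eq_sym zm0 z0.
exists (\row_j (z ord0 (lift ord_max j) / z ord0 ord_max)); last first.
  by move=> j; rewrite mxE mulrC divfK.
apply/chain_polytopeP; split=> [j|]; first by rewrite mxE divr_ge0.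
rewrite [X in heaviest _ _ X](_ : _ = fun j => (z ord0 ord_max)^-1 *
    ((fun i => z ord0 i) \o lift ord_max) j); last first.
  by apply/funext => j; rewrite mxE mulrC.
by rewrite heaviestZ ?invr_ge0// mulrC ler_pdivrMr// mul1r.
Qed.

(** The base of the pyramid keeps the chain polytope, so only the bottom
    coordinate is modified.  Adding to it the heaviest chain above turns the
    constraint that a chain through the bottom weighs at most 1 into the
    constraint that the height of the pyramid is at most 1. *)
Lemma pyramid_chain_polytope_transfer :
  transfer p' (fun i y => if i == ord_max then heaviest p' (above p' i) y else 0)
    (@pyramid R d (chain_polytope p)).
Proof.
have p'_inj := add_bottom_inj.
split.
- move=> x y a b /pyramid_chain_polytopeP[x0 x1 xm] /pyramid_chain_polytopeP[y0 y1 ym].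
  move=> a0 b0 ab; apply/pyramid_chain_polytopeP; split=> [i||].
  + by rewrite !mxE addr_ge0 ?mulr_ge0.
  + rewrite !mxE -ab -[X in _ <= X + _]mulr1 -[X in _ <= _ + X]mulr1.
    by rewrite lerD ?ler_wpM2l.
  + under [X in heaviest _ _ X]eq_fun do rewrite !mxE.
    by rewrite !mxE; exact: mixing_heaviest_le.
- apply/pyramid_chain_polytopeP; split=> [i||]; rewrite ?mxE//.
  under [X in heaviest _ _ X]eq_fun do rewrite mxE.
  by apply/heaviest_leP => // C _ _; rewrite /weight big1.
- move=> i y z yz; case: ifP => // _; apply: eq_heaviest => j.
  by rewrite inE; exact: yz.
- move=> i m F tF /=; case: (i == ord_max); first exact: tropical_heaviest.
  exact: tropical0.
- move=> y y0 y1; apply/pyramid_chain_polytopeP.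
  have ym : y ord_max + heaviest p' (above p' ord_max) y <= 1.
    by apply: le_trans y1; apply: heaviest_step; rewrite // ?inE ?finset.subsetT.
  split=> [i||]; rewrite ?mxE ?eqxx//.
    by case: ifP; rewrite ?addr0 ?addr_ge0 ?heaviest_ge0.
  apply: (@le_trans _ _ (heaviest p' (above p' ord_max) y)); last by rewrite lerDr.
  apply: heaviest_le => i; rewrite inE mxE.
  by case: eqVneq => [->|]; rewrite ?ltxx ?addr0.
- move=> y v a y0 /pyramid_chain_polytopeP[v0 v1 vm] a0 yv.
  apply: (@le_trans _ _ (y ord_max + heaviest p' (above p' ord_max) y)); last first.
    have := yv ord_max; rewrite eqxx => /le_trans; apply.
    by rewrite -[leRHS]mulr1 ler_wpM2l.
  apply: heaviest_bottom_le => // [|j _]; first by rewrite addr_ge0 ?heaviest_ge0.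
  have [->//|jm] := eqVneq j ord_max.
  rewrite -[leLHS]add0r lerD//; apply: heaviest_step => //.
    rewrite inE add_bottom_max; case: (unliftP ord_max j) jm => [k ->|->]; last by rewrite eqxx.
    by rewrite add_bottom_lift lt_inl_inr.
  apply/fintype.subsetP => x; rewrite !inE; apply: le_lt_trans.
  by rewrite add_bottom_max; case: (unliftP ord_max j) => [k ->|->];
    rewrite ?add_bottom_lift ?add_bottom_max.
- move=> y v a i y0 /pyramid_chain_polytopeP[v0 v1 vm] a0 yv.
  have [im|im] := eqVneq i ord_max; last by rewrite mulr_ge0.
  rewrite im in yv *; apply: le_trans (ler_wpM2l a0 vm).
  rewrite -heaviestZ//; apply: heaviest_le => j; rewrite inE => mj.
  have := yv j mj; rewrite ifF ?addr0//.
  by apply: contraTF mj => /eqP ->; rewrite ltxx.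
Qed.

End Bottom.

(** A common linear extension of P and Q extends to one of P' and Q' by placing
    the new element, labelled [ord_max], first. *)
Lemma ordsum_position {dP : Order.disp_t} {P : finPOrderType dP} {d : nat}
    (p : 'I_d -> P) (pos : 'I_d -> nat) :
  (forall i j, (p i < p j)%O -> (pos i < pos j)%N) ->
  forall i j, (add_bottom p i < add_bottom p j)%O ->
  (oapp (S \o pos) 0%N (unlift ord_max i) < oapp (S \o pos) 0%N (unlift ord_max j))%N.
Proof.
move=> pos_p i j; case: (unliftP ord_max i) => [i' ->|->];
  case: (unliftP ord_max j) => [j' ->|->] //=;
  rewrite ?add_bottom_max ?add_bottom_lift ?lt_inr_inl ?lt_inl// lt_inr.
exact: pos_p.
Qed.

(** * The six polytopes *)

Theorem theorem1p4 (R : realType) (d : nat)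
    (dP dQ : Order.disp_t) (P : finPOrderType dP) (Q : finPOrderType dQ)
    (p : 'I_d -> P) (q : 'I_d -> Q)
    (p' := add_bottom p) (q' := add_bottom q)
    (polytopes : seq (set 'rV[R]_d.+1) := [:: Omega (order_polytope p) (order_polytope q);
                      Omega (order_polytope p) (chain_polytope q);
                      Omega (chain_polytope p) (chain_polytope q);
                      Gamma (order_polytope p') (order_polytope q');
                      Gamma (order_polytope p') (chain_polytope q');
                      Gamma (chain_polytope p') (chain_polytope q')]) :
  (0 < d)%N -> bijective p -> bijective q ->
  (exists sigma : 'S_d, linear_extension p sigma /\ linear_extension q sigma) ->
  {in polytopes &, forall A B,
    (forall m : nat, (0 < m)%N -> ehrhart A m = ehrhart B m) /\
    volume A = volume B}.
Proof.
move=> _ /bij_inj p_inj /bij_inj q_inj [sigma [sigma_p sigma_q]].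
have p'_inj := add_bottom_inj p_inj; have q'_inj := add_bottom_inj q_inj.
pose pos0 (i : 'I_d) : nat := (sigma^-1)%g i.
pose pos i := oapp (S \o pos0) 0%N (unlift ord_max i).
have pos_inj : injective pos.
  move=> i j; rewrite /pos; case: (unliftP ord_max i) => [i' ->|->];
    case: (unliftP ord_max j) => [j' ->|->] //= [] /val_inj/perm_inj -> //.
have pos_p i j : (p' i < p' j)%O -> (pos i < pos j)%N.
  by apply: ordsum_position => {}i {}j ij; apply: sigma_p; rewrite !permKV.
have pos_q i j : (q' i < q' j)%O -> (pos i < pos j)%N.
  by apply: ordsum_position => {}i {}j ij; apply: sigma_q; rewrite !permKV.
pose K : set 'rV[R]_d.+1 := weight_ball p' q'.
have good U V (B C : set 'rV[R]_d.+1) : transfer p' U B -> transfer q' V C ->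
    (forall m, ehrhart (Gamma B C) m = ehrhart K m) /\
    volume (Gamma B C) = volume K.
  by move=> tU tV; exact: (ehrhart_volume_Gamma p'_inj q'_inj tU tV pos_inj pos_p pos_q).
have op := order_polytope_transfer (R := R) p'_inj.
have oq := order_polytope_transfer (R := R) q'_inj.
have cp := chain_polytope_transfer (R := R) p'.
have cq := chain_polytope_transfer (R := R) q'.
have yp := pyramid_chain_polytope_transfer (R := R) p_inj.
have yq := pyramid_chain_polytope_transfer (R := R) q_inj.
have o0 (dS : Order.disp_t) (S : finPOrderType dS) (s : 'I_d -> S) :
    (order_polytope s : set 'rV[R]_d) 0.
  by split=> [i|i j _]; rewrite !mxE ?lexx ?ler01.
have c0 (dS : Order.disp_t) (S : finPOrderType dS) (s : 'I_d -> S) :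
    (chain_polytope s : set 'rV[R]_d) 0.
  exact: transfer_origin (chain_polytope_transfer s).
have all_good A : A \in polytopes ->
    (forall m, ehrhart A m = ehrhart K m) /\
    volume A = volume K.
  rewrite /polytopes !inE !Omega_pyramid// !pyramid_order_polytope.
  by move=> /or4P[|||/or3P[]] /eqP ->; apply: good; eassumption.
by move=> A B /all_good[eA vA] /all_good[eB vB]; split=> [m _|]; rewrite ?eA ?eB ?vA ?vB.
Qed.
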